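(* Let $P$ be a differentiable manifold, $\mathfrak{g}$ a Lie algebra, $\Gamma:\mathfrak{g}\to\mathcal{X}(P)$ a morphism of Lie algebras from $\mathfrak{g}$ to the Lie algebra of vector fields on $P$, and $r\in\wedge^2\mathfrak{g}$ a solution of the classical Yang-Baxter equation such that $\mathrm{Im}\,r$ is a unimodular Lie algebra. Then, for any volume form $\epsilon$ on $P$ such that $L_{\Gamma(u)}\epsilon=0$ for each $u\in \mathrm{Im}\,r$, the bivector field $\Gamma(r)$ is compatible with $\epsilon$, i.e. $$d\left(i_{\Gamma(r)}\epsilon\right)=0.$$
   Context: Manifolds, vector fields and forms are smooth; Lie algebras are real and finite-dimensional. $\mathcal{X}(P)$ is the Lie algebra of vector fields on $P$ and $L$ denotes the Lie derivative. For $r\in\wedge^2\mathfrak{g}$, also write $r:\mathfrak{g}^*\to\mathfrak{g}$ for the induced linear map, $\beta(r(\alpha))=r(\alpha,\beta)$, and $\mathrm{Im}\,r\subset\mathfrak{g}$ for its image. The bivector $r$ is a solution of the classical Yang-Baxter equation if $[r,r]=0$, where $[r,r]\in\wedge^3\mathfrak{g}$ is defined by $$[r,r](\alpha,\beta,\gamma)=\alpha([r(\beta),r(\gamma)])+\beta([r(\gamma),r(\alpha)])+\gamma([r(\alpha),r(\beta)]),\qquad \alpha,\beta,\gamma\in\mathfrak{g}^*.$$ In that case $\mathrm{Im}\,r$ is a Lie subalgebra of $\mathfrak{g}$. A Lie algebra is unimodular if $\mathrm{tr}(\mathrm{ad}_z)=0$ for each of its elements $z$. If $r=\sum_{i<j}a_{ij}\,u_i\wedge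 u_j$ in a basis $(u_i)$ of $\mathfrak{g}$, then $\Gamma(r)=\sum_{i<j}a_{ij}\,\Gamma(u_i)\wedge\Gamma(u_j)$; this is a Poisson tensor on $P$. $i_{\Gamma(r)}\epsilon$ is the contraction of $\epsilon$ with the bivector field $\Gamma(r)$. *)

(* Defs.v *)
From HB Require Import structures.
From mathcomp Require Import all_boot all_order all_algebra.
From mathcomp Require Import all_classical all_reals all_analysis.

Set Implicit Arguments.
Unset Strict Implicit.
Unset Printing Implicit Defensive.

Import Order.TTheory GRing.Theory Num.Theory.
Import numFieldNormedType.Exports.

Local Open Scope classical_set_scope.
Local Open Scope ring_scope.

(** * Lie algebras and bivectors *)

HB.mixin Record isLieAlgebra (R : fieldType) g of Vector R g := {
  lie_bracket : g -> g -> g;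
  lie_linear_l : forall y, linear (lie_bracket^~ y);
  lie_linear_r : forall x, linear (lie_bracket x);
  lie_alternating : forall x, lie_bracket x x = 0;
  lie_jacobi : forall x y z,
    lie_bracket x (lie_bracket y z) + lie_bracket y (lie_bracket z x) +
    lie_bracket z (lie_bracket x y) = 0 }.

#[short(type="lieAlgType")]
HB.structure Definition LieAlgebra (R : fieldType) :=
  {g of isLieAlgebra R g & Vector R g}.

Notation dual_space g := 'Hom(g, _^o).

Section Bivector.
Context {R : realType} {g : lieAlgType R}.

(* For [f]-stable [U] this is the trace of [f] restricted to [U]. *)
Definition trace_on (U : {vspace g}) (f : g -> g) : R :=
  \sum_(i < \dim U) coord (vbasis U) i (f (vbasis U)`_i).

Definition unimodular (h : {vspace g}) : Prop :=
  forall z, z \in h -> trace_on h (lie_bracket z) = 0.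

Definition dual_basis (u : (\dim {:g}).-tuple g) (i : 'I_(\dim {:g})) :
  dual_space g := linfun (coord u i : g -> R^o).

(* An element of the exterior square of [g] is represented by the skew form
   it induces on the dual: the form of [u /\ v] is
   [fun a b => a u * b v - a v * b u]. *)
Definition sharp (r : {skew_symmetric (dual_space g)}) : 'Hom(dual_space g, g) :=
  linfun (fun alpha : dual_space g =>
    \sum_i r alpha (dual_basis (vbasis {:g}) i) *: (vbasis {:g})`_i).

Lemma dual_basisE (u : (\dim {:g}).-tuple g) i x :
  dual_basis u i x = coord u i x.
Proof. by rewrite lfunE. Qed.

Lemma dual_decomp (u : (\dim {:g}).-tuple g) (alpha : dual_space g) :
  basis_of {:g} u ->
  alpha = \sum_(i < \dim {:g}) alpha u`_i *: dual_basis u i.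
Proof.
move=> ub; apply/lfunP => x; rewrite sum_lfunE.
rewrite {1}(coord_basis ub (memvf x)) linear_sum; apply: eq_bigr => i _.
by rewrite linearZ /= scale_lfunE dual_basisE /GRing.scale /= mulrC.
Qed.

Lemma sharpE r (alpha beta : dual_space g) : beta (sharp r alpha) = r alpha beta.
Proof.
set u := vbasis {:g}.
have sl : linear (fun a : dual_space g => \sum_i r a (dual_basis u i) *: u`_i).
  move=> c a b; rewrite scaler_sumr -big_split; apply: eq_bigr => i _ /=.
  by rewrite linearPl /= scalerDl scalerA.
pose sA := GRing.isLinear.Build _ _ _ _ _ sl.
pose sL : {linear dual_space g -> g} := HB.pack
  (fun a : dual_space g => \sum_i r a (dual_basis u i) *: u`_i) sA.
rewrite /sharp (lfunE sL) /= linear_sum /=.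
rewrite [in RHS](dual_decomp beta (vbasisP {:g})) linear_sumr.
by apply: eq_bigr => i _; rewrite linearZ linearZr_LR /= /GRing.scale /= mulrC.
Qed.

Definition CYBE (r : {skew_symmetric (dual_space g)}) : Prop :=
  forall alpha beta gamma : dual_space g,
    alpha (lie_bracket (sharp r beta) (sharp r gamma)) +
    beta (lie_bracket (sharp r gamma) (sharp r alpha)) +
    gamma (lie_bracket (sharp r alpha) (sharp r beta)) = 0.

Lemma limg_sharp_subalgebra (r : {skew_symmetric (dual_space g)}) x y :
  CYBE r -> x \in limg (sharp r) -> y \in limg (sharp r) ->
  lie_bracket x y \in limg (sharp r).
Proof.
move=> yb /memv_imgP[beta _ ->] /memv_imgP[gamma _ ->].
pose ad z : {linear g -> g} :=
  HB.pack (lie_bracket z) (GRing.isLinear.Build _ _ _ _ _ (lie_linear_r z)).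
have lieN a b : lie_bracket a b = - lie_bracket b a.
  have lD c u v : lie_bracket (u + v) c = lie_bracket u c + lie_bracket v c.
    by have := lie_linear_l c 1 u v; rewrite !scale1r.
  have rD c u v : lie_bracket c (u + v) = lie_bracket c u + lie_bracket c v.
    by have := lie_linear_r c 1 u v; rewrite !scale1r.
  apply/eqP; rewrite -addr_eq0; apply/eqP.
  have := lie_alternating (a + b).
  by rewrite lD !rD !lie_alternating add0r addr0.
have rN a b : r a b = - r b a.
  by rewrite [LHS](hermitian_subproof a b) /= expr1 mulN1r.
have pull (a : dual_space g) z v :
    (a \o linfun (ad z))%VF v = a (lie_bracket z v) :> R.
  by rewrite comp_lfunE lfunE.
suff -> : lie_bracket (sharp r beta) (sharp r gamma) =
    sharp r ((beta \o linfun (ad (sharp r gamma))) -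
             (gamma \o linfun (ad (sharp r beta))))%VF by rewrite memv_img ?memvf.
have sep (a b : g) : (forall f : dual_space g, f a = f b) -> a = b.
  move=> ab; rewrite (coord_basis (vbasisP {:g}) (memvf a)).
  rewrite [RHS](coord_basis (vbasisP {:g}) (memvf b)); apply: eq_bigr => i _.
  by rewrite -!dual_basisE ab.
apply: sep => alpha; rewrite sharpE rN -sharpE !(add_lfunE, opp_lfunE) !pull.
have /eqP := yb alpha beta gamma.
rewrite -addrA addr_eq0 => /eqP ->.
by rewrite [lie_bracket _ (sharp r beta)]lieN linearN.
Qed.

End Bivector.

(** * Smooth manifolds *)

Section Smooth.
Context {R : realType} {n : nat}.

Fixpoint Ck_on {W : normedModType R} (k : nat) (V : set 'rV[R]_n)
    (f : 'rV[R]_n -> W) : Prop :=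
  if k is k'.+1 then
    (forall x, V x -> differentiable f x) /\
    (forall v, Ck_on k' V (fun x => 'D_v f x))
  else forall x, V x -> {for x, continuous f}.

(* Meant for open [V]; only the values of [f] on [V] then matter. *)
Definition smooth_on {W : normedModType R} (V : set 'rV[R]_n)
    (f : 'rV[R]_n -> W) : Prop :=
  forall k, Ck_on k V f.

Record chart (T : topologicalType) := Chart {
  chart_dom : set T;
  chart_map : T -> 'rV[R]_n;
  chart_inv : 'rV[R]_n -> T;
  chart_dom_open : open chart_dom;
  chart_img_open : open (chart_map @` chart_dom);
  chart_mapK : forall p, chart_dom p -> chart_inv (chart_map p) = p;
  chart_map_cont : forall p, chart_dom p -> {for p, continuous chart_map};
  chart_inv_cont : forall x, (chart_map @` chart_dom) x ->
    {for x, continuous chart_inv} }.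

Definition transition {T : topologicalType} (c c' : chart T) :
    'rV[R]_n -> 'rV[R]_n :=
  chart_map c' \o chart_inv c.

End Smooth.

Arguments chart R n T : clear implicits.

Record manifold (R : realType) (n : nat) := Manifold {
  manifold_space :> topologicalType;
  manifold_hausdorff : hausdorff_space manifold_space;
  manifold_second_countable : @second_countable manifold_space;
  atlas : set (chart R n manifold_space);
  atlas_cover : forall p : manifold_space, exists2 c, atlas c & chart_dom c p;
  atlas_smooth : forall c c', atlas c -> atlas c' ->
    smooth_on (chart_map c @` (chart_dom c `&` chart_dom c'))
      (transition c c') }.

Arguments atlas {R n} m.

(** * Tensor fields

    A chart [chart_at p] of the atlas around each point [p] is chosen once and
    for all; the tangent space at [p] is ['rV[R]_n], a tangent vector being
    given by its coordinates in [chart_at p].  The [k]-tuples of tangent vectors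
    at [p] are the rows of the matrices in ['M[R]_(k, n)].  The coordinates of
    a tensor field in another chart are obtained with the Jacobian matrices of
    the transition maps, and smoothness is required in all charts. *)

Section Tensors.
Context {R : realType} {n : nat} (M : manifold R n).

Definition chart_at (p : M) : chart R n M := s2val (cid2 (atlas_cover p)).

Definition vf_in_chart (c : chart R n M) (X : M -> 'rV[R]_n)
    (x : 'rV[R]_n) : 'rV[R]_n :=
  let q := chart_inv c x in
  X q *m jacobian (transition (chart_at q) c) (chart_map (chart_at q) q).

Record vector_field := VectorField {
  vf_val :> M -> 'rV[R]_n;
  vf_smooth : forall c, atlas M c ->
    smooth_on (chart_map c @` chart_dom c) (vf_in_chart c vf_val) }.

Definition vf_bracket (X Y : M -> 'rV[R]_n) (p : M) : 'rV[R]_n :=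
  let c := chart_at p in
  'D_(X p) (vf_in_chart c Y) (chart_map c p) -
  'D_(Y p) (vf_in_chart c X) (chart_map c p).

Definition form_in_chart (c : chart R n M) k (w : M -> 'M[R]_(k, n) -> R)
    (x : 'rV[R]_n) (V : 'M[R]_(k, n)) : R :=
  let q := chart_inv c x in
  w q (V *m jacobian (transition c (chart_at q)) x).

Definition multilinear_alternating k (f : 'M[R]_(k, n) -> R) : Prop :=
  (forall (A B C : 'M[R]_(k, n)) i0 b c,
     row i0 A = b *: row i0 B + c *: row i0 C ->
     row' i0 B = row' i0 A -> row' i0 C = row' i0 A ->
     f A = b * f B + c * f C) /\
  (forall (A : 'M[R]_(k, n)) i1 i2, i1 != i2 -> row i1 A = row i2 A -> f A = 0).

Record diff_form (k : nat) := DiffForm {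
  form_val :> M -> 'M[R]_(k, n) -> R;
  form_alt : forall p, multilinear_alternating (form_val p);
  form_smooth : forall c, atlas M c -> forall V : 'M[R]_(k, n),
    smooth_on (chart_map c @` chart_dom c)
      (fun x => form_in_chart c form_val x V) }.

Definition volume_form (w : diff_form n) : Prop :=
  forall p, exists V, w p V != 0.

(* The value of Palais' formula for [d] on the vector fields that are constant
   in [chart_at p]; their brackets vanish. *)
Definition ext_d k (w : M -> 'M[R]_(k, n) -> R) (p : M)
    (V : 'M[R]_(k.+1, n)) : R :=
  let c := chart_at p in
  \sum_(i < k.+1) (-1) ^+ i *
    'D_(row i V) (fun x => form_in_chart c w x (row' i V)) (chart_map c p).

(* The value of
   [X (w (V_1, .., V_k)) - \sum_j w (V_1, .., lie_bracket X V_j, .., V_k)]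
   on vector fields [V_j] that are constant in [chart_at p]; the bracket of [X]
   with [V_j] is then the opposite of the derivative of [X] along [V_j]. *)
Definition lie_derivative k (X : M -> 'rV[R]_n) (w : M -> 'M[R]_(k, n) -> R)
    (p : M) (V : 'M[R]_(k, n)) : R :=
  let c := chart_at p in
  'D_(X p) (fun x => form_in_chart c w x V) (chart_map c p) +
  \sum_(j < k) w p (\matrix_(l < k)
    if l == j then 'D_(row j V) (vf_in_chart c X) (chart_map c p) else row l V).

(* A bivector is represented by its antisymmetric matrix of components [B],
   standing for [\sum_(a < b) B a b e_a /\ e_b]. *)
Definition wedge (x y : 'rV[R]_n) : 'M[R]_n := x^T *m y - y^T *m x.

(* The contraction by [x /\ y] is [fun V => w (x, y, V)]; forms of degree 0 and
   1 have contraction 0, which lives in degree 0 since [k.-2] is truncated. *)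
Definition contract_bivector k (B : 'M[R]_n) :
    ('M[R]_(k, n) -> R) -> 'M[R]_(k.-2, n) -> R :=
  if k is k'.+2 then fun w V =>
    \sum_(a < n) \sum_(b < n | (a < b)%N)
      B a b * w (col_mx (delta_mx 0 a : 'rV_n) (col_mx (delta_mx 0 b : 'rV_n) V))
  else fun _ _ => 0.

End Tensors.

Arguments vector_field {R n} M.
Arguments diff_form {R n} M k.

Section Action.
Context {R : realType} {n : nat} {M : manifold R n} {g : lieAlgType R}.

Definition lie_morphism (Gamma : g -> vector_field M) : Prop :=
  (forall a u v p, Gamma (a *: u + v) p = a *: Gamma u p + Gamma v p) /\
  (forall u v p, Gamma (lie_bracket u v) p = vf_bracket (Gamma u) (Gamma v) p).

Definition bivector_image_in (u : (\dim {:g}).-tuple g)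
    (Gamma : g -> vector_field M) (r : {skew_symmetric (dual_space g)})
    (p : M) : 'M[R]_n :=
  \sum_(i < \dim {:g}) \sum_(j < \dim {:g} | (i < j)%N)
    r (dual_basis u i) (dual_basis u j) *: wedge (Gamma u`_i p) (Gamma u`_j p).

Definition bivector_image := bivector_image_in (vbasis {:g}).

(* The components of the image are [r] on pulled back coordinate covectors, so
   that it does not depend on the basis. *)
Lemma bivector_image_inE (u : (\dim {:g}).-tuple g)
    (Gamma : g -> vector_field M) (r : {skew_symmetric (dual_space g)}) p a b :
  basis_of {:g} u -> lie_morphism Gamma ->
  bivector_image_in u Gamma r p a b =
  r (linfun (fun w : g => Gamma w p 0 a : R^o))
    (linfun (fun w : g => Gamma w p 0 b : R^o)).
Proof.
move=> ub [Glin _].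
have lin c : linear (fun w : g => Gamma w p 0 c : R^o).
  by move=> k v w /=; rewrite Glin !mxE.
have linE c x : linfun (fun w : g => Gamma w p 0 c : R^o) x = Gamma x p 0 c.
  pose sL : {linear g -> R^o} := HB.pack
    (fun w : g => Gamma w p 0 c : R^o) (GRing.isLinear.Build _ _ _ _ _ (lin c)).
  by rewrite (lfunE sL).
have rN x y : r x y = - r y x.
  by rewrite [LHS](hermitian_subproof x y) /= expr1 mulN1r.
have r0 x : r x x = 0.
  by have /eqP := rN x x; rewrite -addr_eq0 -mulr2n mulrn_eq0 => /eqP.
set d := dual_basis u.
pose F i j := r (d i) (d j) * (Gamma u`_i p 0 a * Gamma u`_j p 0 b).
have Fii i : F i i = 0 by rewrite /F r0 mul0r.
transitivity (\sum_i \sum_j F i j).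
  rewrite /bivector_image_in summxE.
  transitivity (\sum_(i < \dim {:g}) (\sum_(j < \dim {:g} | (i < j)%N) F i j +
      \sum_(j < \dim {:g} | (i < j)%N) F j i)).
    apply: eq_bigr => i _; rewrite summxE -big_split; apply: eq_bigr => j _ /=.
    by rewrite !mxE !big_ord1 !mxE /F (rN (d j)) mulrBr mulNr.
  rewrite big_split /= [X in _ + X](exchange_big_dep xpredT)//= -big_split /=.
  apply: eq_bigr => i _.
  rewrite [RHS](bigID (fun j : 'I_(\dim {:g}) => (i < j)%N)) /=; congr (_ + _).
  rewrite [RHS](bigD1 i) ?ltnn//= Fii add0r; apply: eq_bigl => j.
  by rewrite -leqNgt ltn_neqAle andbC.
rewrite [in RHS](dual_decomp (linfun (fun w : g => Gamma w p 0 a : R^o)) ub).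
rewrite linear_sumlz; apply: eq_bigr => i _.
rewrite linearZl_LR /=.
rewrite [in RHS](dual_decomp (linfun (fun w : g => Gamma w p 0 b : R^o)) ub).
rewrite linear_sumr mulr_sumr; apply: eq_bigr => j _.
by rewrite linearZr_LR /= /F !linE mulrC mulrA.
Qed.

End Action.

(* Main.v *)
(* In the coordinates around a point the volume form is f times the determinant,
   so the contraction by Gamma(r) has exterior derivative the contraction of the
   determinant by the divergence of the bivector field f Gamma(r).  Expand r in a
   basis (v_i) of Im r, with coefficients a_ij.  The condition
   L_{Gamma(v_i)} epsilon = 0 says that f Gamma(v_i) has divergence 0, so only
   the brackets remain and the divergence is, up to a factor, the value of f Gamma
   at \sum a_ij [v_i, v_j].  This element of g vanishes: contracting two arguments
   of the Yang-Baxter equation with the inverse of r on Im r turns it into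
   traces of ad_z on Im r, which are 0 by unimodularity. *)

From HB Require Import structures.
Require Import Defs.
From mathcomp Require Import all_boot all_order all_fingroup all_algebra.
From mathcomp Require Import ring.
From mathcomp Require Import all_classical all_reals all_analysis.

Set Implicit Arguments.
Unset Strict Implicit.
Unset Printing Implicit Defensive.

Import Order.TTheory GRing.Theory Num.Theory.
Import numFieldNormedType.Exports.

Local Open Scope classical_set_scope.
Local Open Scope ring_scope.

(** * Alternating multilinear functions of matrix rows, and determinants *)

Section AlternatingForms.
Context {R : realType}.

Definition set_row {k n : nat} (i0 : 'I_k) (v : 'rV[R]_n) (A : 'M[R]_(k, n)) :=
  \matrix_(i, j) if i == i0 then v 0 j else A i j.

Lemma row_set_row k n (i0 : 'I_k) v (A : 'M[R]_(k, n)) :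
  row i0 (set_row i0 v A) = v.
Proof. by apply/rowP => j; rewrite !mxE eqxx. Qed.

Lemma row'_set_row k n (i0 : 'I_k) v (A : 'M[R]_(k, n)) :
  row' i0 (set_row i0 v A) = row' i0 A.
Proof. by apply/matrixP => i j; rewrite !mxE eq_sym (negbTE (neq_lift _ _)). Qed.

Lemma set_row_id k n (i0 : 'I_k) (A : 'M[R]_(k, n)) :
  set_row i0 (row i0 A) A = A.
Proof. by apply/matrixP => i j; rewrite !mxE; case: eqP => // ->. Qed.

(** The family [F] stands for a matrix with a free row [i0]. Keeping it abstract covers both
    [set_row] and stacked blocks [col_mx]. *)
Lemma alternating_row_sum k n (f : 'M[R]_(k, n) -> R) i0
    (F : 'rV[R]_n -> 'M[R]_(k, n)) :
  multilinear_alternating f -> (forall v, row i0 (F v) = v) ->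
  (forall u v, row' i0 (F u) = row' i0 (F v)) ->
  forall v, f (F v) = \sum_c v 0 c * f (F (delta_mx 0 c)).
Proof.
move=> [fl _] Fr Fr' v.
have lin : linear (fun v : 'rV[R]_n => f (F v) : R^o).
  move=> b x y; rewrite /GRing.scale /= -[f (F y)]mul1r.
  by apply: (fl _ _ _ i0) => //; rewrite !Fr scale1r.
pose sL : {linear 'rV[R]_n -> R^o} := HB.pack
  (fun v : 'rV[R]_n => f (F v) : R^o) (GRing.isLinear.Build _ _ _ _ _ lin).
rewrite -[f (F v)]/(sL v) [in LHS](row_sum_delta v) linear_sum.
by apply: eq_bigr => c _; rewrite linearZ.
Qed.

Lemma determinant_alternating n :
  multilinear_alternating (fun A : 'M[R]_n => \det A).
Proof.
split=> [A B C i0 b c|A i1 i2 i12 rA]; first exact: determinant_multilinear.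
by apply: (determinant_alternate i12) => j; move/rowP: rA => /(_ j); rewrite !mxE.
Qed.

Lemma alternating_mulmxr k n m (f : 'M[R]_(k, n) -> R) (J : 'M[R]_(m, n)) :
  multilinear_alternating f ->
  multilinear_alternating (fun A : 'M[R]_(k, m) => f (A *m J)).
Proof.
move=> [fl fa]; split=> [A B C i0 b c rA rB rC|A i1 i2 i12 rA]; last first.
  by apply: fa i12 _; rewrite !row_mul rA.
have row'M (B' : 'M[R]_(k, m)) : row' i0 (B' *m J) = row' i0 B' *m J.
  by apply/matrixP => i j; rewrite !mxE; apply: eq_bigr => h _; rewrite !mxE.
by apply: (fl _ _ _ i0); rewrite ?row'M ?rB ?rC //;
  rewrite !row_mul rA mulmxDl -!scalemxAl.
Qed.

(** Polarization: with the sum of the two rows placed in both positions [f] vanishes, and only the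
    two cross terms survive in the expansion. *)
Lemma alternating_xrow k n (f : 'M[R]_(k, n) -> R) i1 i2 (A : 'M[R]_(k, n)) :
  multilinear_alternating f -> i1 != i2 -> f (xrow i1 i2 A) = - f A.
Proof.
move=> fA i12; have [fl fa] := fA.
have fD i u v B :
    f (set_row i (u + v) B) = f (set_row i u B) + f (set_row i v B).
  rewrite -[f (set_row i u B)]mul1r -[f (set_row i v B)]mul1r.
  by apply: (fl _ _ _ i); rewrite ?row'_set_row// !row_set_row !scale1r.
have rC u v :
    set_row i1 u (set_row i2 v A) = set_row i2 v (set_row i1 u A).
  apply/matrixP => i j; rewrite !mxE.
  by case: eqP => [->|//]; rewrite (negbTE i12).
have f0 u : f (set_row i1 u (set_row i2 u A)) = 0.
  by apply: fa i12 _; rewrite row_set_row rC row_set_row.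
have := f0 (row i1 A + row i2 A).
rewrite fD !rC !fD -!rC !f0 add0r addr0 set_row_id.
have -> : set_row i1 (row i1 A) A = A by exact: set_row_id.
move=> /eqP; rewrite addrC addr_eq0 => /eqP <-; congr f.
apply/matrixP => i j; rewrite !mxE.
case: (eqVneq i i1) => [->|n1]; first by rewrite tpermL.
by case: (eqVneq i i2) => [->|n2]; rewrite ?tpermR ?tpermD // eq_sym.
Qed.

Lemma alternating_perm_mx n (f : 'M[R]_n -> R) (s : 'S_n) :
  multilinear_alternating f -> f (perm_mx s) = f 1%:M * (-1) ^+ odd_perm s.
Proof.
move=> fA; have [ts -> dts] := prod_tpermP s.
rewrite odd_perm_prod // signr_odd.
elim: ts dts => [|[i j] ts IH] /=; first by rewrite big_nil perm_mx1 mulr1.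
move=> /andP[ij /IH {}IH]; rewrite big_cons perm_mxM.
by rewrite -[perm_mx _]/(tperm_mx i j) -xrowE alternating_xrow // IH exprS mulN1r mulrN.
Qed.

(** Multilinearity reduces the rows to basis vectors, one at a time. The matrix is then a
    permutation matrix, or has two equal rows and both sides vanish. *)
Lemma alternating_detE n (f : 'M[R]_n -> R) : multilinear_alternating f ->
  forall A, f A = f 1%:M * \det A.
Proof.
move=> fA A; have detA := @determinant_alternating n.
(* The rows of index at least [s] are basis vectors: [s = n] imposes nothing, [s = 0] constrains
   every row. *)
suff H s B :
    (forall i : 'I_n, (s <= i)%N -> exists j, row i B = delta_mx 0 j) ->
    f B = f 1%:M * \det B.
  by apply: (H n) => i; rewrite leqNgt ltn_ord.
elim: s B => [|s IH] B Bd.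
  have [t tE] := choice (fun i => Bd i (leq0n i)).
  have BE i j : B i j = (t i == j)%:R.
    by move/rowP: (tE i) => /(_ j); rewrite !mxE eqxx eq_sym.
  have [/injectiveP ti|/injectivePn[i1 [i2 i12 ti]]] := boolP (injectiveb t).
    have -> : B = perm_mx (perm ti).
      by apply/matrixP => i j; rewrite BE !mxE permE.
    by rewrite alternating_perm_mx // det_perm.
  have rB : row i1 B = row i2 B by rewrite !tE ti.
  by rewrite (fA.2 _ _ _ i12 rB) (detA.2 _ _ _ i12 rB) mulr0.
have [sn|ns] := ltnP s n; last first.
  by apply: IH => i; rewrite leqNgt (leq_trans (ltn_ord i) ns).
pose i0 := Ordinal sn; pose F v := set_row i0 v B.
have FE : B = F (row i0 B) by rewrite /F set_row_id.
have Fr v : row i0 (F v) = v by exact: row_set_row.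
have Fr' u v : row' i0 (F u) = row' i0 (F v) by rewrite !row'_set_row.
rewrite FE (alternating_row_sum fA Fr Fr') (alternating_row_sum detA Fr Fr').
rewrite mulr_sumr; apply: eq_bigr => c _; rewrite IH 1?mulrCA // => i si.
have [->|ni] := eqVneq i i0; first by exists c; rewrite Fr.
have [j Bj] : exists j, row i B = delta_mx 0 j.
  by apply: Bd; rewrite ltn_neqAle si andbT eq_sym.
exists j; rewrite -Bj; apply/rowP => l; rewrite !mxE.
by rewrite (negbTE ni).
Qed.

Lemma row0_col_mx k n (x : 'rV[R]_n) (B : 'M[R]_(k, n)) :
  row (ord0 : 'I_k.+1) (col_mx x B) = x.
Proof.
by apply/rowP => j; rewrite !mxE; case: splitP => // i _; rewrite (ord1 i).
Qed.

Lemma rowS_col_mx k n (x : 'rV[R]_n) (B : 'M[R]_(k, n)) (i : 'I_k) :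
  row (lift ord0 i) (col_mx x B) = row i B.
Proof.
by apply/rowP => j; rewrite !mxE; case: splitP => a;
  rewrite ?ord1 // => -[] /val_inj ->.
Qed.

Lemma row'0_col_mx k n (x : 'rV[R]_n) (B : 'M[R]_(k, n)) :
  row' (ord0 : 'I_k.+1) (col_mx x B) = B.
Proof.
by apply/matrixP => i j; rewrite !mxE; case: splitP => a;
  rewrite ?ord1 // => -[] /val_inj ->.
Qed.

Lemma row'S_col_mx k n (x : 'rV[R]_n) (B : 'M[R]_(k.+1, n)) (i : 'I_k.+1) :
  row' (lift ord0 i : 'I_(1 + k.+1)) (col_mx x B) = col_mx x (row' i B).
Proof.
apply/row_matrixP => a; rewrite row_rowsub.
case: (unliftP ord0 a) => [b ->|->]; last first.
  rewrite row0_col_mx -[RHS](row0_col_mx x B).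
  by congr row; apply: val_inj.
rewrite rowS_col_mx row_rowsub -(rowS_col_mx x B).
by congr row; apply: val_inj; rewrite /= /bump /= !add1n ltnS addnS.
Qed.

(** With [l] the gradient of a function, the left side is the alternating sum occurring in an
    exterior derivative; only the derivatives along [x] and [y] remain. *)
Lemma det_row_functional m (x y : 'rV[R]_m.+2) (V : 'M[R]_(m.+1, m.+2))
    (l : 'cV[R]_m.+2) :
  \sum_(i < m.+1) (-1) ^+ i *
    ((row i V *m l) 0 0 * \det (col_mx x (col_mx y (row' i V)))) =
  (y *m l) 0 0 * \det (col_mx x V) - (x *m l) 0 0 * \det (col_mx y V).
Proof.
set Z : 'M[R]_(m.+3, m.+2) := col_mx x (col_mx y V).
(* The first column of the square matrix [Z l | Z] is a combination of the
   others; the identity is the expansion of its determinant along it. *)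
have : \det (row_mx (Z *m l) Z : 'M[R]_m.+3) = 0.
  have -> : (row_mx (Z *m l) Z : 'M[R]_m.+3) =
      (row_mx 0 Z : 'M[R]_(m.+3, 1 + m.+2)) *m block_mx 1%:M 0 l 1%:M.
    by rewrite mul_row_block !mul0mx !add0r mulmx1.
  rewrite det_mulmx (expand_det_col _ 0) big1 ?mul0r // => i _.
  by rewrite mxE; case: splitP => // c _; rewrite mxE mul0r.
have col'Z (i : 'I_m.+3) :
    row' i (col' 0 (row_mx (Z *m l) Z : 'M[R]_(m.+3, 1 + m.+2)))
    = row' i Z :> 'M[R]_m.+2.
  move: Z => Z'; apply/matrixP => a b; rewrite !mxE; case: splitP => [c|c] /=.
    by rewrite (ord1 c).
  by rewrite /bump /= => -[] bc; congr (Z' _ _); apply/val_inj.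
have col0 (i : 'I_m.+3) : (row_mx (Z *m l) Z : 'M[R]_(m.+3, 1 + m.+2)) i 0 =
    (row i Z *m l) 0 0.
  by rewrite -row_mul !mxE; case: splitP => // c _; rewrite !mxE (ord1 c).
rewrite (expand_det_col _ 0) /cofactor.
under eq_bigr do rewrite col'Z col0 addn0.
rewrite big_ord_recl big_ord_recl !row0_col_mx rowS_col_mx row0_col_mx.
rewrite row'0_col_mx row'S_col_mx row'0_col_mx expr0 mul1r expr1 mulN1r mulrN.
under eq_bigr => i _.
  rewrite !rowS_col_mx !row'S_col_mx /= /bump /= !add1n !exprS !mulN1r opprK.
  rewrite mulrCA; over.
move=> /eqP; rewrite addrA addr_eq0 => /eqP yx.
by apply: oppr_inj; rewrite -yx opprB.
Qed.
End AlternatingForms.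

(** * The bivector on its image and the Yang-Baxter equation *)

Section LieAlgebra.
Context {R : realType} {g : lieAlgType R}.
Implicit Types (x y : g) (alpha beta : dual_space g).

HB.instance Definition _ x :=
  GRing.isLinear.Build R g g *:%R (lie_bracket x) (lie_linear_r x).

Lemma lie_bracketC x y : lie_bracket x y = - lie_bracket y x.
Proof.
have lD c u v : lie_bracket (u + v) c = lie_bracket u c + lie_bracket v c.
  by have := lie_linear_l c 1 u v; rewrite !scale1r.
have rD c u v : lie_bracket c (u + v) = lie_bracket c u + lie_bracket c v.
  by have := lie_linear_r c 1 u v; rewrite !scale1r.
apply/eqP; rewrite -addr_eq0; apply/eqP; have := lie_alternating (x + y).
by rewrite lD !rD !lie_alternating add0r addr0.
Qed.

Lemma dual_sep x y : (forall alpha, alpha x = alpha y) -> x = y.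
Proof.
move=> xy; rewrite (coord_basis (vbasisP {:g}) (memvf x)).
rewrite [RHS](coord_basis (vbasisP {:g}) (memvf y)); apply: eq_bigr => i _.
by rewrite -!dual_basisE xy.
Qed.

Context (r : {skew_symmetric (dual_space g)}).
Let h := limg (sharp r).
Let v := vbasis h.

(** The coordinate forms of a basis of Im r, extended to [g] by [coord]. Since [r] sees only the
    restrictions of its arguments to Im r, its values do not depend on the extension. *)
Definition image_dual (i : 'I_(\dim h)) : dual_space g :=
  linfun (coord v i : g -> R^o).

Definition image_coef (i j : 'I_(\dim h)) : R :=
  r (image_dual i) (image_dual j).

Lemma skewC alpha beta : r alpha beta = - r beta alpha.
Proof. by rewrite [LHS](hermitian_subproof alpha beta) /= expr1 mulN1r. Qed.

Lemma image_coefC i j : image_coef i j = - image_coef j i.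
Proof. exact: skewC. Qed.

Lemma sharp_in alpha : sharp r alpha \in h.
Proof. by rewrite memv_img ?memvf. Qed.

Lemma sharp_coord alpha :
  sharp r alpha = \sum_i r alpha (image_dual i) *: v`_i.
Proof.
rewrite [LHS](coord_vbasis (sharp_in alpha)); apply: eq_bigr => i _.
by rewrite -sharpE lfunE.
Qed.

Lemma form_image_dual alpha j :
  r alpha (image_dual j) = \sum_i image_coef i j * alpha v`_i.
Proof.
rewrite skewC -sharpE sharp_coord linear_sum -sumrN; apply: eq_bigr => i _.
by rewrite linearZ /= -mulNr -image_coefC.
Qed.

(** The bivector lies in the exterior square of its image: [sharp r alpha] is expanded in the basis
    of Im r, then skew-symmetry does the same for the other argument. *)
Lemma bivector_image_coef alpha beta :
  r alpha beta = \sum_i \sum_j image_coef i j * (alpha v`_i * beta v`_j).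
Proof.
rewrite -sharpE sharp_coord linear_sum exchange_big /=; apply: eq_bigr => j _.
rewrite linearZ /= form_image_dual /GRing.scale /= mulr_suml.
by apply: eq_bigr => i _; rewrite mulrA.
Qed.

Lemma unimodular_bracket_sum : CYBE r -> unimodular h ->
  \sum_i \sum_j image_coef i j *: lie_bracket v`_i v`_j = 0.
Proof.
move=> yb um; apply: dual_sep => gamma; rewrite linear0.
have vh (i : 'I_(\dim h)) : v`_i \in h.
  by rewrite vbasis_mem // mem_nth // size_tuple.
(* The preimages [al i] encode the inverse of [r] on Im r. *)
have /fin_all_exists[al alE] (i : 'I_(\dim h)) :
    exists alpha, sharp r alpha = v`_i.
  by have /memv_imgP[alpha _ ->] := vh i; exists alpha.
have trE z :
    \sum_i image_dual i (lie_bracket z v`_i) = trace_on h (lie_bracket z).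
  by apply: eq_bigr => i _; rewrite lfunE.
pose z := sharp r gamma.
have tr0 : \sum_i image_dual i (lie_bracket z v`_i) = 0.
  by rewrite trE um // sharp_in.
(* Summed over [i], this is minus the value of [gamma] at the element that must vanish. *)
have first_term i : gamma (lie_bracket (sharp r (image_dual i)) v`_i) =
    - \sum_j image_coef i j * gamma (lie_bracket v`_i v`_j).
  rewrite lie_bracketC linearN sharp_coord !linear_sum /=.
  by apply: eq_bigr => j _; rewrite !linearZ /=.
(* As Im r is a subalgebra, [lie_bracket z v_j] has a preimage [de j]. Skew-symmetry replaces [al i]
   at this bracket by minus [de j] at [v_i], and summing over [i] gives back minus the trace of
   ad_z. *)
have third : \sum_i al i (lie_bracket z (sharp r (image_dual i))) = 0.
  have /fin_all_exists[de deE] (i : 'I_(\dim h)) :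
      exists delta, sharp r delta = lie_bracket z v`_i.
    have /memv_imgP[delta _ ->] :=
      limg_sharp_subalgebra yb (sharp_in gamma) (vh i).
    by exists delta.
  have alE' (i j : 'I_(\dim h)) : al i (lie_bracket z v`_j) = - de j v`_i.
    by rewrite -deE sharpE skewC -sharpE alE.
  transitivity (- \sum_j \sum_i image_coef i j * de j v`_i).
    rewrite exchange_big /= -sumrN; apply: eq_bigr => i _.
    rewrite sharp_coord !linear_sum; apply: eq_bigr => j _.
    by rewrite !linearZ /= alE' /GRing.scale /= mulrN.
  apply/eqP; rewrite oppr_eq0; apply/eqP; rewrite -[RHS]tr0.
  apply: eq_bigr => j _.
  by rewrite -form_image_dual -sharpE deE.
(* The Yang-Baxter equation at gamma, v^i and a preimage of v_i under r: the
   last two terms sum to traces of ad_z. *)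
have : \sum_i (gamma (lie_bracket (sharp r (image_dual i)) (sharp r (al i))) +
    image_dual i (lie_bracket (sharp r (al i)) (sharp r gamma)) +
    al i (lie_bracket (sharp r gamma) (sharp r (image_dual i)))) = 0.
  by rewrite big1 // => i _; rewrite yb.
rewrite !big_split /= third addr0.
under [X in _ + X]eq_bigr do rewrite alE lie_bracketC linearN.
rewrite sumrN tr0 subr0 => /eqP.
under eq_bigr do rewrite alE first_term.
rewrite sumrN oppr_eq0 => /eqP S0; rewrite -[RHS]S0 linear_sum.
apply: eq_bigr => i _; rewrite linear_sum.
by apply: eq_bigr => j _; rewrite linearZ.
Qed.

End LieAlgebra.

Arguments image_coef {R g} r i j.

(** * Derivatives of components and sums, and the exterior derivative of a contracted determinant *)

Section Differentiation.
Context {R : realType}.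

Lemma derive_partial n (f : 'rV[R]_n -> R) x (v : 'rV[R]_n) :
  differentiable f x -> 'D_v f x = \sum_i v 0 i * 'D_(delta_mx 0 i) f x.
Proof.
move=> df; rewrite deriveE // [in LHS](row_sum_delta v) linear_sum.
by apply: eq_bigr => i _; rewrite linearZ deriveE.
Qed.

Lemma differentiable_entry (V : normedModType R) m n (X : V -> 'M[R]_(m, n))
    x i j :
  differentiable X x -> differentiable (fun y => X y i j) x.
Proof.
move=> dX.
apply: (@differentiable_comp _ _ _ _ X (fun N : 'M[R]_(m, n) => N i j)) => //.
exact: differentiable_coord.
Qed.

Lemma derive_entry (V : normedModType R) m n (X : V -> 'M[R]_(m, n)) x v i j :
  differentiable X x -> 'D_v (fun y => X y i j) x = ('D_v X x) i j.
Proof. by move=> dX; rewrite derive_mx ?mxE //; exact: diff_derivable. Qed.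

Lemma differentiable_big (V W : normedModType R) (I : finType)
    (f : I -> V -> W) x :
  (forall i, differentiable (f i) x) ->
  differentiable (fun y => \sum_i f i y) x.
Proof.
move=> df; rewrite (_ : (fun _ => _) = \sum_i f i); last first.
  by apply/funext => y; rewrite fct_sumE.
by elim/big_ind: _ => // a b; exact: differentiableD.
Qed.

Lemma derive_big (V W : normedModType R) (I : finType) (f : I -> V -> W) x v :
  (forall i, differentiable (f i) x) ->
  'D_v (fun y => \sum_i f i y) x = \sum_i 'D_v (f i) x.
Proof.
move=> df; rewrite deriveE; last exact: differentiable_big.
have -> : (fun y => \sum_i f i y) = \sum_i f i.
  by apply/funext => y; rewrite fct_sumE.
have [//] : differentiable (\sum_i f i) x /\
  'd (\sum_i f i) x v = \sum_i 'D_v (f i) x.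
elim/big_ind2: _ => [|a b c d [dc <-] [dd <-]|i _].
- by split; [exact: differentiable_cst|rewrite -deriveE ?derive_cst].
- by split; [exact: differentiableD|rewrite diffD].
- by rewrite deriveE.
Qed.

Context {m : nat}.
Local Notation n := m.+2.

(* The exterior derivative of the contraction of the standard volume form by a
   bivector field is the contraction by its divergence. *)
Lemma ext_d_contract_det (B : 'I_n -> 'I_n -> 'rV[R]_n -> R) x
    (V : 'M[R]_(m.+1, n)) :
  (forall a b, differentiable (B a b) x) ->
  (forall a b y, B a b y = - B b a y) ->
  (forall a, \sum_b 'D_(delta_mx 0 b) (B a b) x = 0) ->
  \sum_(i < m.+1) (-1) ^+ i * 'D_(row i V) (fun y => \sum_a \sum_b
    B a b y * \det (col_mx (delta_mx 0 a : 'rV_n)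
      (col_mx (delta_mx 0 b : 'rV_n) (row' i V)))) x
  = 0.
Proof.
move=> dB BN div0.
(* The gradient of [B a b] as a column, in the shape that [det_row_functional] takes. *)
pose l a b : 'cV[R]_n := \col_c 'D_(delta_mx 0 c) (B a b) x.
have lE a b (v : 'rV[R]_n) : 'D_v (B a b) x = (v *m l a b) 0 0.
  by rewrite derive_partial // mxE; apply: eq_bigr => c _; rewrite mxE.
have dBM a b (w : R) : differentiable (fun y => B a b y * w) x.
  by apply: differentiableM => //; exact: differentiable_cst.
transitivity (\sum_(i < m.+1) \sum_a \sum_b (-1) ^+ i *
    ((row i V *m l a b) 0 0 * \det (col_mx (delta_mx 0 a : 'rV_n)
      (col_mx (delta_mx 0 b : 'rV_n) (row' i V))))).
  apply: eq_bigr => i _; rewrite derive_big; last first.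
    by move=> a; apply: differentiable_big.
  rewrite mulr_sumr; apply: eq_bigr => a _; rewrite derive_big //.
  rewrite mulr_sumr; apply: eq_bigr => b _; congr (_ * _).
  by rewrite -lE deriveMr 1?mulrC //; exact: diff_derivable.
have rl a b c : ((delta_mx 0 c : 'rV[R]_n) *m l a b) 0 0 =
    'D_(delta_mx 0 c) (B a b) x.
  by rewrite -lE.
rewrite exchange_big /=; under eq_bigr do rewrite exchange_big /=.
under eq_bigr => a _ do under eq_bigr => b _ do rewrite det_row_functional !rl.
under eq_bigr do rewrite big_split /=.
(* The terms with leading row e_a carry the divergence of row [a] of [B]. The others sum over the
   first index of [B], which skew-symmetry turns into minus the divergence of row [b]. *)
rewrite big_split /= big1 ?add0r; last first.
  by move=> a _; rewrite -mulr_suml div0 mul0r.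
rewrite exchange_big big1 //= => b _; rewrite sumrN -mulr_suml.
suff -> : \sum_a 'D_(delta_mx 0 a) (B a b) x = 0 by rewrite mul0r oppr0.
transitivity (- \sum_a 'D_(delta_mx 0 a) (B b a) x); last by rewrite div0 oppr0.
rewrite -sumrN; apply: eq_bigr => a _.
have -> : B a b = - B b a by apply/funext => y; rewrite BN.
by rewrite deriveN //; exact: diff_derivable.
Qed.

End Differentiation.

(** * Contraction of alternating forms by bivectors *)

Section Contraction.
Context {R : realType}.

Lemma alternating_pair_sum k n (w : 'M[R]_(k.+2, n) -> R) (x y : 'rV[R]_n)
    (V : 'M[R]_(k, n)) :
  multilinear_alternating w ->
  w (col_mx x (col_mx y V)) = \sum_a \sum_b x 0 a * y 0 b *
    w (col_mx (delta_mx 0 a : 'rV_n) (col_mx (delta_mx 0 b : 'rV_n) V)).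
Proof.
move=> wA.
pose F (u : 'rV[R]_n) : 'M[R]_(k.+2, n) := col_mx u (col_mx y V).
have F1 u : row ord0 (F u) = u by exact: row0_col_mx.
have F2 u v : row' ord0 (F u) = row' ord0 (F v) by rewrite !row'0_col_mx.
rewrite (alternating_row_sum wA F1 F2); apply: eq_bigr => a _.
pose G (u : 'rV[R]_n) : 'M[R]_(k.+2, n) :=
  col_mx (delta_mx 0 a : 'rV_n) (col_mx u V).
have G1 u : row (lift ord0 ord0) (G u) = u by rewrite rowS_col_mx row0_col_mx.
have G2 u v : row' (lift ord0 ord0) (G u) = row' (lift ord0 ord0) (G v).
  by rewrite !row'S_col_mx !row'0_col_mx.
rewrite -[F _]/(G y) (alternating_row_sum wA G1 G2) mulr_sumr.
by apply: eq_bigr => b _; rewrite mulrA.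
Qed.

Lemma alternating_pairC k n (w : 'M[R]_(k.+2, n) -> R) (x y : 'rV[R]_n)
    (V : 'M[R]_(k, n)) :
  multilinear_alternating w ->
  w (col_mx x (col_mx y V)) = - w (col_mx y (col_mx x V)).
Proof.
move=> wA; rewrite -(@alternating_xrow _ _ _ _ ord0 (lift ord0 ord0)) //.
congr w; apply/row_matrixP => i.
have -> : forall A : 'M[R]_(k.+2, n), row i (xrow ord0 (lift ord0 ord0) A) =
    row (tperm ord0 (lift ord0 ord0) i) A.
  by move=> A; apply/rowP => j; rewrite !mxE.
case: (unliftP ord0 i) => [i' ->|->]; last first.
  by rewrite tpermL rowS_col_mx !row0_col_mx.
case: (unliftP ord0 i') => [i'' ->|->]; last first.
  by rewrite tpermR rowS_col_mx !row0_col_mx.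
by rewrite tpermD // !rowS_col_mx.
Qed.

(** Both factors change sign when [a] and [b] are exchanged, so the sum over [a < b] is half of the
    full sum. *)
Lemma contract_bivector_sum k n (B : 'M[R]_n) (w : 'M[R]_(k.+2, n) -> R)
    (V : 'M[R]_(k, n)) :
  multilinear_alternating w -> (forall a b, B a b = - B b a) ->
  contract_bivector B w V = \sum_a \sum_b 2^-1 * B a b *
    w (col_mx (delta_mx 0 a : 'rV_n) (col_mx (delta_mx 0 b : 'rV_n) V)).
Proof.
move=> wA BN; rewrite /contract_bivector.
pose F a b := B a b *
  w (col_mx (delta_mx 0 a : 'rV_n) (col_mx (delta_mx 0 b : 'rV_n) V)).
have FC a b : F a b = F b a by rewrite /F BN alternating_pairC // mulrNN.
have F0 a : F a a = 0.
  have /eqP := BN a a; rewrite -addr_eq0 -mulr2n mulrn_eq0 => /eqP B0.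
  by rewrite /F B0 mul0r.
have -> : \sum_a \sum_b 2^-1 * B a b *
    w (col_mx (delta_mx 0 a : 'rV_n) (col_mx (delta_mx 0 b : 'rV_n) V)) =
    2^-1 * \sum_a \sum_b F a b.
  rewrite mulr_sumr; apply: eq_bigr => a _; rewrite mulr_sumr.
  by apply: eq_bigr => b _; rewrite mulrA.
have -> : \sum_a \sum_b F a b = 2 * \sum_(a < n) \sum_(b < n | (a < b)%N) F a b.
  transitivity (\sum_(a < n) (\sum_(b < n | (a < b)%N) F a b +
      \sum_(b < n | (b < a)%N) F a b)).
    apply: eq_bigr => a _.
    rewrite (bigID (fun b : 'I_n => (a < b)%N)) /=; congr (_ + _).
    rewrite (bigD1 a) ?ltnn//= F0 add0r; apply: eq_bigl => b.
    by rewrite -leqNgt ltn_neqAle andbC.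
  rewrite big_split /= [X in _ + X](exchange_big_dep xpredT)//=.
  rewrite mulr_natl mulr2n; congr (_ + _).
  by apply: eq_bigr => a _; apply: eq_bigr => b _.
by rewrite mulKf // pnatr_eq0.
Qed.

(** In the expansion of row [j], every basis vector other than the [j]-th repeats a row of the
    identity. Summing such determinants over [j] will produce a divergence. *)
Lemma det_set_row1 n (j : 'I_n) (u : 'rV[R]_n) :
  \det (set_row j u 1%:M) = u 0 j.
Proof.
rewrite (alternating_row_sum (@determinant_alternating R n) (i0 := j)
  (F := fun u => set_row j u 1%:M)); last 2 first.
- by move=> v; rewrite row_set_row.
- by move=> v v'; rewrite !row'_set_row.
rewrite (bigD1 j) //= big1 ?addr0 => [|c cj].
  by rewrite -row1 set_row_id det1 mulr1.
rewrite (determinant_alternate (i1 := c) (i2 := j)) ?mulr0 // => l.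
by rewrite !mxE !eqxx (negbTE cj) /= eq_sym.
Qed.

End Contraction.

(** * Divergence of a bivector field built from vector fields *)

Section Divergence.
Context {R : realType} {n : nat}.
Local Notation E b := (delta_mx 0 b : 'rV[R]_n).

Lemma derive_mul (f g : 'rV[R]_n -> R) x v :
  differentiable f x -> differentiable g x ->
  'D_v (fun y => f y * g y) x = f x * 'D_v g x + g x * 'D_v f x.
Proof. by move=> df dg; rewrite deriveM //; exact: diff_derivable. Qed.

(** The product rule splits the divergence into [X i] times the divergence of [f X_j], which is zero
    by assumption, and [f] times the derivative of [X i] along [X j]. Skew-symmetry of [a] expresses
    the latter through brackets. *)
Lemma divergence_sum (I : finType) (a : I -> I -> R) (f : 'rV[R]_n -> R)
    (X : I -> 'rV[R]_n -> 'rV[R]_n) x :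
  (forall i j, a i j = - a j i) ->
  differentiable f x -> (forall i, differentiable (X i) x) ->
  (forall i, 'D_(X i x) f x + f x * \sum_b 'D_(E b) (X i) x 0 b = 0) ->
  \sum_i \sum_j a i j *: ('D_(X i x) (X j) x - 'D_(X j x) (X i) x) = 0 ->
  forall k, \sum_b 'D_(E b) (fun y => f y *
    \sum_i \sum_j a i j * (X i y 0 k * X j y 0 b)) x = 0.
Proof.
move=> aN df dX Xf0 br0 k.
have dXk i b : differentiable (fun y => X i y 0 b) x.
  by exact: differentiable_entry.
have dXX i j b : differentiable (fun y => a i j * (X i y 0 k * X j y 0 b)) x.
  by apply: differentiableM; [exact: differentiable_cst|exact: differentiableM].
have dS b : differentiable
    (fun y => \sum_i \sum_j a i j * (X i y 0 k * X j y 0 b)) x.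
  by apply: differentiable_big => i; exact: differentiable_big.
have DX i j : 'D_(X j x) (X i) x 0 k = \sum_b X j x 0 b * 'D_(E b) (X i) x 0 k.
  rewrite -derive_entry // derive_partial //.
  by apply: eq_bigr => b _; rewrite derive_entry.
transitivity (\sum_i \sum_j a i j *
    (X i x 0 k * ('D_(X j x) f x + f x * \sum_b 'D_(E b) (X j) x 0 b) +
     f x * 'D_(X j x) (X i) x 0 k)).
  transitivity (\sum_b \sum_i \sum_j a i j *
    (f x * (X i x 0 k * 'D_(E b) (X j) x 0 b +
            X j x 0 b * 'D_(E b) (X i) x 0 k) +
     X i x 0 k * X j x 0 b * 'D_(E b) f x)).
    apply: eq_bigr => b _; rewrite derive_mul // derive_big.
      rewrite mulr_sumr mulr_suml -big_split; apply: eq_bigr => i _ /=.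
      rewrite derive_big // mulr_sumr mulr_suml -big_split.
      apply: eq_bigr => j _ /=.
      rewrite derive_mul ?derive_cst //; last exact: differentiableM.
      rewrite derive_mul // !derive_entry //; ring.
    by move=> i; exact: differentiable_big.
  rewrite exchange_big; apply: eq_bigr => i _ /=.
  rewrite exchange_big; apply: eq_bigr => j _ /=.
  rewrite (DX i j).
  rewrite (derive_partial (X j x) df).
  rewrite !(mulrDr, mulr_sumr) -!big_split /=.
  by apply: eq_bigr => b _ /=; ring.
have -> : \sum_i \sum_j a i j *
    (X i x 0 k * ('D_(X j x) f x + f x * \sum_b 'D_(E b) (X j) x 0 b) +
     f x * 'D_(X j x) (X i) x 0 k) =
    f x * (\sum_i \sum_j a i j *: 'D_(X j x) (X i) x) 0 k.
  rewrite summxE mulr_sumr; apply: eq_bigr => i _; rewrite summxE mulr_sumr.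
  by apply: eq_bigr => j _; rewrite Xf0 mulr0 add0r mxE mulrCA.
set S := \sum_i _; suff -> : S = 0 by rewrite mxE mulr0.
(* The bracket sum is therefore [- S - S], and its vanishing forces [S = 0]. *)
have S' : \sum_i \sum_j a i j *: 'D_(X i x) (X j) x = - S.
  rewrite exchange_big -sumrN; apply: eq_bigr => i _ /=; rewrite -sumrN.
  by apply: eq_bigr => j _; rewrite aN scaleNr.
move: br0; under eq_bigr do under eq_bigr do rewrite scalerBr.
under eq_bigr do rewrite sumrB; rewrite sumrB S' -/S -opprD => /eqP.
by rewrite oppr_eq0 -mulr2n -scaler_nat scaler_eq0 pnatr_eq0 /= => /eqP.
Qed.

End Divergence.

(** * Changes of chart and coordinate expressions of tensor fields *)

Section Charts.
Context {R : realType} {n : nat} (M : manifold R n).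
Implicit Types (c : chart R n M) (p q : M).

Lemma chart_at_atlas p : atlas M (chart_at p).
Proof. by rewrite /chart_at; case: cid2. Qed.

Lemma chart_at_dom p : chart_dom (chart_at p) p.
Proof. by rewrite /chart_at; case: cid2. Qed.

(** Allows identities near a point to be checked at [chart_map c q] with [q] in the domain, where
    [chart_inv] is a genuine inverse. *)
Lemma near_chart c (D : set M) p : chart_dom c p -> nbhs p D ->
  \forall x \near chart_map c p,
    exists2 q, chart_dom c q /\ D q & x = chart_map c q.
Proof.
move=> cp Dp.
have im : (chart_map c @` chart_dom c) (chart_map c p) by exists p.
have near_im : \forall x \near chart_map c p, (chart_map c @` chart_dom c) x.
  by apply: open_nbhs_nbhs; split => //; exact: chart_img_open.
have near_D : \forall x \near chart_map c p, D (chart_inv c x).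
  by apply: (chart_inv_cont im); rewrite chart_mapK.
near=> x.
have [q cq qx] : (chart_map c @` chart_dom c) x by near: x.
exists q => //; split => //; rewrite -(chart_mapK cq) qx.
by near: x.
Unshelve. all: by end_near. Qed.

Lemma differentiable_transition c c' p : atlas M c -> atlas M c' ->
  chart_dom c p -> chart_dom c' p ->
  differentiable (transition c c') (chart_map c p).
Proof.
move=> ac ac' cp c'p; have [dt _] := atlas_smooth ac ac' 1.
by apply: dt; exists p.
Qed.

Lemma transition_map c c' q : chart_dom c q ->
  transition c c' (chart_map c q) = chart_map c' q.
Proof. by move=> cq; rewrite /transition /= chart_mapK. Qed.

Lemma jacobian_near_id (f : 'rV[R]_n -> 'rV[R]_n) x : differentiable f x ->
  (\forall y \near x, f y = y) -> jacobian f x = 1%:M.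
Proof.
move=> df fid; apply/row_matrixP => i.
rewrite rowE -deriveEjacobian // (near_eq_derive _ fid) row1.
exact: derive_id.
Qed.

Lemma jacobian_transition_id c p : atlas M c -> chart_dom c p ->
  jacobian (transition c c) (chart_map c p) = 1%:M.
Proof.
move=> ac cp; apply: jacobian_near_id; first exact: differentiable_transition.
apply: filterS (near_chart (D := setT) cp filterT) => x [q [cq _] ->].
by rewrite transition_map.
Qed.

(** Chain rule for the composite of the two transitions, which is the identity on the image of the
    overlap. With row vectors the factors appear in order of application. *)
Lemma jacobian_transitionK c c' p : atlas M c -> atlas M c' ->
  chart_dom c p -> chart_dom c' p ->
  jacobian (transition c c') (chart_map c p) *m
  jacobian (transition c' c) (chart_map c' p) = 1%:M.
Proof.
move=> ac ac' cp c'p.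
have dt := differentiable_transition ac ac' cp c'p.
have dt1 := differentiable_transition ac' ac c'p cp.
have dt2 : differentiable (transition c' c) (transition c c' (chart_map c p)).
  by rewrite transition_map.
have c'n : nbhs p (chart_dom c').
  by apply: open_nbhs_nbhs; split => //; exact: chart_dom_open.
have near_id : \forall x \near chart_map c p,
    (transition c' c \o transition c c') x = x.
  apply: filterS (near_chart cp c'n) => x [q [cq c'q] ->] /=.
  by rewrite transition_map // transition_map.
apply/row_matrixP => i; rewrite rowE mulmxA -deriveEjacobian //.
rewrite -(transition_map c' cp) -deriveEjacobian // row1.
rewrite deriveE // [X in 'd _ _ X]deriveE //.
rewrite -[LHS]/(('d (transition c' c) (transition c c' (chart_map c p)) \o
  'd (transition c c') (chart_map c p)) (delta_mx 0 i)).
rewrite -diff_comp // -deriveE; last exact: differentiable_comp.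
by rewrite (near_eq_derive _ near_id); exact: derive_id.
Qed.

Lemma vf_in_chartE c X q : chart_dom c q ->
  vf_in_chart c X (chart_map c q) =
  X q *m jacobian (transition (chart_at q) c) (chart_map (chart_at q) q).
Proof. by move=> cq; rewrite /vf_in_chart /= chart_mapK. Qed.

Lemma vf_in_chartK c X q : atlas M c -> chart_dom c q ->
  vf_in_chart c X (chart_map c q) *m
  jacobian (transition c (chart_at q)) (chart_map c q) = X q.
Proof.
move=> ac cq; rewrite vf_in_chartE // -mulmxA jacobian_transitionK ?mulmx1 //.
- exact: chart_at_atlas.
- exact: chart_at_dom.
Qed.

Lemma vf_in_chart_at X p :
  vf_in_chart (chart_at p) X (chart_map (chart_at p) p) = X p.
Proof.
have cp := chart_at_dom p.
rewrite vf_in_chartE // jacobian_transition_id ?mulmx1 //.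
exact: chart_at_atlas.
Qed.

Lemma form_in_chartE c k (w : M -> 'M[R]_(k, n) -> R) q A : chart_dom c q ->
  form_in_chart c w (chart_map c q) A =
  w q (A *m jacobian (transition c (chart_at q)) (chart_map c q)).
Proof. by move=> cq; rewrite /form_in_chart /= chart_mapK. Qed.

Lemma form_in_chart_at k (w : M -> 'M[R]_(k, n) -> R) p A :
  form_in_chart (chart_at p) w (chart_map (chart_at p) p) A = w p A.
Proof.
have cp := chart_at_dom p.
rewrite form_in_chartE // jacobian_transition_id ?mulmx1 //.
exact: chart_at_atlas.
Qed.

(** At any [x], even outside the image of [c], this is an alternating form precomposed with a
    matrix, so [alternating_detE] applies. *)
Lemma form_in_chart_det c (w : diff_form M n) x A :
  form_in_chart c w x A = form_in_chart c w x 1%:M * \det A.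
Proof.
rewrite /form_in_chart; set J := jacobian _ _; set q := chart_inv c x.
exact: (alternating_detE (alternating_mulmxr J (form_alt w q))).
Qed.

Lemma vf_differentiable c (X : vector_field M) p : atlas M c -> chart_dom c p ->
  differentiable (vf_in_chart c X) (chart_map c p).
Proof.
by move=> ac cp; have [dX _] := vf_smooth X ac 1; apply: dX; exists p.
Qed.

Lemma form_differentiable c k (w : diff_form M k) V p :
  atlas M c -> chart_dom c p ->
  differentiable (fun x => form_in_chart c w x V) (chart_map c p).
Proof.
by move=> ac cp; have [dw _] := form_smooth w ac V 1; apply: dw; exists p.
Qed.

End Charts.

(** * The action and the volume form in coordinates *)

Section Action.
Context {R : realType} {m : nat} {M : manifold R m.+2} {g : lieAlgType R}.
Local Notation n := m.+2.
Context (Gamma : g -> vector_field M) (r : {skew_symmetric (dual_space g)}).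
Context (Gmor : lie_morphism Gamma).
Let h := limg (sharp r).
Let v := vbasis h.

Lemma lie_morphism_sum (I : finType) (a : I -> R) (w : I -> g) p :
  Gamma (\sum_i a i *: w i) p = \sum_i a i *: Gamma (w i) p.
Proof.
have Glin : linear (fun u => Gamma u p) by move=> b x y; rewrite Gmor.1.
pose sL : {linear g -> 'rV[R]_n} := HB.pack
  (fun u => Gamma u p) (GRing.isLinear.Build _ _ _ _ _ Glin).
rewrite -[LHS]/(sL _) linear_sum; apply: eq_bigr => i _.
by rewrite linearZ.
Qed.

(** Passes from the basis of [g] to one of Im r, so that only fields preserving the volume form will
    occur. *)
Lemma bivector_image_entry p a b : bivector_image Gamma r p a b =
  \sum_i \sum_j image_coef r i j * (Gamma v`_i p 0 a * Gamma v`_j p 0 b).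
Proof.
rewrite /bivector_image bivector_image_inE ?vbasisP // bivector_image_coef.
have linE c x : linfun (fun w : g => Gamma w p 0 c : R^o) x = Gamma x p 0 c.
  have lin : linear (fun w : g => Gamma w p 0 c : R^o).
    by move=> k w w' /=; rewrite Gmor.1 !mxE.
  pose sL : {linear g -> R^o} := HB.pack
    (fun w : g => Gamma w p 0 c : R^o) (GRing.isLinear.Build _ _ _ _ _ lin).
  by rewrite (lfunE sL).
by apply: eq_bigr => i _; apply: eq_bigr => j _; rewrite !linE.
Qed.

(** The contraction at [q] is defined in the frame of [chart_at q], the right side in that of [c].
    The two are compared through the values of [eps] on the vectors [Gamma v_i] and [Gamma v_j],
    which refer to no frame. *)
Lemma contract_bivector_image_in_chart c (eps : diff_form M n) q
    (A : 'M[R]_(m, n)) : atlas M c -> chart_dom c q ->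
  form_in_chart c
    (fun q => contract_bivector (bivector_image Gamma r q) (eps q))
    (chart_map c q) A =
  \sum_a \sum_b (form_in_chart c eps (chart_map c q) 1%:M *
    \sum_i \sum_j (2^-1 * image_coef r i j) *
      (vf_in_chart c (Gamma v`_i) (chart_map c q) 0 a *
       vf_in_chart c (Gamma v`_j) (chart_map c q) 0 b)) *
    \det (col_mx (delta_mx 0 a : 'rV_n) (col_mx (delta_mx 0 b : 'rV_n) A)).
Proof.
move=> ac cq; set x := chart_map c q; set f := form_in_chart c eps x 1%:M.
pose X i := vf_in_chart c (Gamma v`_i) x.
set J := jacobian (transition c (chart_at q)) x.
have BN a b : bivector_image Gamma r q a b = - bivector_image Gamma r q b a.
  rewrite !bivector_image_entry exchange_big -sumrN; apply: eq_bigr => i _ /=.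
  rewrite -sumrN; apply: eq_bigr => j _.
  by rewrite image_coefC mulNr [X in _ * X]mulrC.
rewrite form_in_chartE // (contract_bivector_sum _ (form_alt eps q) BN).
transitivity (\sum_i \sum_j (2^-1 * image_coef r i j) * (f *
    \det (col_mx (X i) (col_mx (X j) A)))).
  transitivity (\sum_i \sum_j (2^-1 * image_coef r i j) *
      eps q (col_mx (Gamma v`_i q) (col_mx (Gamma v`_j q) (A *m J)))).
    pose G i j a b := (2^-1 * image_coef r i j) *
      (Gamma v`_i q 0 a * Gamma v`_j q 0 b * eps q (col_mx
        (delta_mx 0 a : 'rV_n) (col_mx (delta_mx 0 b : 'rV_n) (A *m J)))).
    transitivity (\sum_a \sum_b \sum_i \sum_j G i j a b).
      apply: eq_bigr => a _; apply: eq_bigr => b _.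
      rewrite bivector_image_entry mulr_sumr mulr_suml; apply: eq_bigr => i _.
      rewrite mulr_sumr mulr_suml; apply: eq_bigr => j _; rewrite /G.
      by rewrite !mulrA.
    under eq_bigr do rewrite exchange_big /=.
    rewrite exchange_big; apply: eq_bigr => i _ /=.
    under eq_bigr do rewrite exchange_big /=.
    rewrite exchange_big; apply: eq_bigr => j _ /=.
    rewrite (alternating_pair_sum _ _ _ (form_alt eps q)) mulr_sumr.
    by apply: eq_bigr => a _; rewrite mulr_sumr.
  apply: eq_bigr => i _; apply: eq_bigr => j _; congr (_ * _).
  (* Read back as [eps] in the chart [c], the determinant has each row multiplied by [J], which
     turns [X i] into [Gamma v_i] at [q]. *)
  rewrite -form_in_chart_det form_in_chartE //.
  rewrite (@mul_col_mx _ 1 (1 + m)) (@mul_col_mx _ 1 m).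
  by rewrite !vf_in_chartK.
pose G i j a b := f * ((2^-1 * image_coef r i j) * (X i 0 a * X j 0 b)) *
  \det (col_mx (delta_mx 0 a : 'rV_n) (col_mx (delta_mx 0 b : 'rV_n) A)).
transitivity (\sum_a \sum_b \sum_i \sum_j G i j a b); last first.
  apply: eq_bigr => a _; apply: eq_bigr => b _.
  rewrite [f * _]mulr_sumr mulr_suml; apply: eq_bigr => i _.
  by rewrite [f * _]mulr_sumr mulr_suml; apply: eq_bigr => j _.
under [RHS]eq_bigr do rewrite exchange_big /=.
rewrite [RHS]exchange_big; apply: eq_bigr => i _ /=.
under [RHS]eq_bigr do rewrite exchange_big /=.
rewrite [RHS]exchange_big; apply: eq_bigr => j _ /=.
rewrite (alternating_pair_sum _ _ _ (@determinant_alternating R n)) !mulr_sumr.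
apply: eq_bigr => a _; rewrite !mulr_sumr; apply: eq_bigr => b _.
by rewrite /G; ring.
Qed.

(** The [j]-th term of the Lie derivative replaces row [j] of the identity by the derivative of [X]
    along e_j, so its determinant is a diagonal entry. The total is the divergence of [X] times the
    density. *)
Lemma lie_derivative_top (X : vector_field M) (eps : diff_form M n) p :
  let c := chart_at p in let x := chart_map c p in
  lie_derivative X eps p 1%:M =
  'D_(vf_in_chart c X x) (fun y => form_in_chart c eps y 1%:M) x +
  form_in_chart c eps x 1%:M *
    \sum_b ('D_(delta_mx 0 b : 'rV_n) (vf_in_chart c X) x) 0 b.
Proof.
move=> c x; rewrite /lie_derivative -/c -/x vf_in_chart_at; congr (_ + _).
rewrite mulr_sumr; apply: eq_bigr => j _.
rewrite -form_in_chart_at -/c -/x form_in_chart_det -det_set_row1.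
congr (_ * \det _); apply/matrixP => i k; rewrite !mxE row1.
by case: eqP => //; rewrite !mxE.
Qed.

End Action.

Theorem theorem1p1 (R : realType) (n : nat) (P : manifold R n)
    (g : lieAlgType R) (Gamma : g -> vector_field P)
    (r : {skew_symmetric (dual_space g)}) :
  lie_morphism Gamma ->
  CYBE r ->
  unimodular (limg (sharp r)) ->
  forall epsilon : diff_form P n,
    volume_form epsilon ->
    (forall u : g, u \in limg (sharp r) ->
       forall p V, lie_derivative (Gamma u) epsilon p V = 0) ->
    forall p V,
      ext_d (fun q => contract_bivector (bivector_image Gamma r q) (epsilon q))
        p V = 0.
Proof.
move=> Gmor yb um eps _ Leps p.
(* In dimensions 0 and 1 the contraction is the constant 0 by definition. *)
case: n P Gamma Gmor eps Leps p => [|[|m]] P Gamma Gmor eps Leps p V.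
- rewrite /ext_d big1 // => i _.
  by rewrite (_ : derive _ _ _ = 0) ?mulr0 //; exact: derive_cst.
- rewrite /ext_d big1 // => i _.
  by rewrite (_ : derive _ _ _ = 0) ?mulr0 //; exact: derive_cst.
have ac := chart_at_atlas p; have cp := chart_at_dom p.
set c := chart_at p in ac cp; pose x := chart_map c p.
(* The factor 1/2 compensates for summing over all pairs of indices. *)
pose v := vbasis (limg (sharp r)); pose a i j := 2^-1 * image_coef r i j.
pose f y := form_in_chart c eps y 1%:M.
pose X (i : 'I_(\dim (limg (sharp r)))) := vf_in_chart c (Gamma v`_i).
have vh (i : 'I_(\dim (limg (sharp r)))) : v`_i \in limg (sharp r).
  by rewrite vbasis_mem // mem_nth // size_tuple.
have df : differentiable f x by exact: form_differentiable.
have dX i : differentiable (X i) x by exact: vf_differentiable.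
have aN i j : a i j = - a j i by rewrite /a image_coefC mulrN.
pose B k l y := f y * \sum_i \sum_j a i j * (X i y 0 k * X j y 0 l).
have dB k l : differentiable (B k l) x.
  apply: differentiableM => //.
  apply: differentiable_big => i; apply: differentiable_big => j.
  apply: differentiableM; first exact: differentiable_cst.
  by apply: differentiableM; exact: differentiable_entry.
have BN k l y : B k l y = - B l k y.
  rewrite /B -mulrN; congr (_ * _).
  rewrite exchange_big -sumrN; apply: eq_bigr => i _ /=.
  rewrite -sumrN; apply: eq_bigr => j _.
  by rewrite aN mulNr [X in _ * X]mulrC.
(* The Lie derivative on the standard basis is the divergence of [f X_i]. *)
have div0 i : 'D_(X i x) f x +
    f x * \sum_b ('D_(delta_mx 0 b : 'rV_m.+2) (X i) x) 0 b = 0.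
  by have := Leps _ (vh i) p 1%:M; rewrite lie_derivative_top.
have bracket0 :
    \sum_i \sum_j a i j *: ('D_(X i x) (X j) x - 'D_(X j x) (X i) x) = 0.
  (* [Gamma] preserves brackets and sums, so the sum is the value of [Gamma] at an element that
     [unimodular_bracket_sum] shows to be zero. *)
  transitivity (\sum_i \sum_j a i j *: Gamma (lie_bracket v`_i v`_j) p).
    apply: eq_bigr => i _; apply: eq_bigr => j _.
    by rewrite Gmor.2 /vf_bracket -/c -/x /X !vf_in_chart_at.
  rewrite pair_bigA -lie_morphism_sum //=.
  rewrite -(pair_bigA _ (fun i j => a i j *: lie_bracket v`_i v`_j)) /=.
  have -> : \sum_i \sum_j a i j *: lie_bracket v`_i v`_j = 0.
    transitivity
      (2^-1 *: \sum_i \sum_j image_coef r i j *: lie_bracket v`_i v`_j);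
      last by rewrite (unimodular_bracket_sum yb um) scaler0.
    rewrite scaler_sumr; apply: eq_bigr => i _.
    rewrite scaler_sumr; apply: eq_bigr => j _.
    by rewrite scalerA.
  (* Linearity with coefficient -1 gives that [Gamma 0] vanishes. *)
  have := Gmor.1 (-1) 0 0 p.
  by rewrite scaler0 add0r scaleN1r addNr.
have div := divergence_sum aN df dX div0 bracket0.
rewrite -[RHS](ext_d_contract_det V dB BN div) /ext_d -/c -/x.
(* The coordinate formula holds on the image of the chart, a neighbourhood of [x], which suffices
   for derivatives at [x]. *)
apply: eq_bigr => i _; congr (_ * _); apply: near_eq_derive.
apply: filterS (near_chart (D := setT) cp filterT) => y [q [cq _] ->].
exact: contract_bivector_image_in_chart.
Qed.
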